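(* For all $x>0$ and $\tau>0$, $$\left|\mathrm{Re}\,K_{1/2+i\tau}(x)\right|\le\sqrt{\frac{\pi^2\tau}{2x\sinh(\pi\tau)}}\qquad\text{and}\qquad\left|\mathrm{Im}\,K_{1/2+i\tau}(x)\right|\le\sqrt{\frac{\pi^2\tau}{2x\sinh(\pi\tau)}} .$$
   Context: $K_z(x)=\int_0^\infty e^{-x\cosh t}\cosh(zt)\,dt$ ($x>0$, $z\in\mathbb{C}$) is the Macdonald function (modified Bessel function of the second kind). *)

(* Defs.v *)
From mathcomp Require Import all_boot all_order all_algebra.
From mathcomp Require Import all_classical all_reals all_analysis.
From mathcomp.real_closed Require Import complex.

Set Implicit Arguments.
Unset Strict Implicit.
Unset Printing Implicit Defensive.

Import Order.TTheory GRing.Theory Num.Theory.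
Import numFieldNormedType.Exports.

Local Open Scope classical_set_scope.
Local Open Scope ring_scope.
Local Open Scope complex_scope.

Definition sinhR (R : realType) (t : R) : R := (expR t - expR (- t)) / 2.

Definition coshR (R : realType) (t : R) : R := (expR t + expR (- t)) / 2.

Definition expC (R : realType) (z : R[i]) : R[i] :=
  (expR (complex.Re z))%:C * (cos (complex.Im z) +i* sin (complex.Im z)).

Definition coshC (R : realType) (z : R[i]) : R[i] := (expC z + expC (- z)) / 2.

(* Lebesgue integral over D of a complex-valued function, taken componentwise;
   as for [Rintegral], the value is only meaningful if both components are
   integrable on D. *)
Definition Cintegral (R : realType) (D : set R) (f : R -> R[i]) : R[i] :=
  (\int[lebesgue_measure]_(t in D) complex.Re (f t)) +i*
  (\int[lebesgue_measure]_(t in D) complex.Im (f t)).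

(* For 0 < x the integrand decays doubly exponentially, so that the Lebesgue
   integral over [0, +oo[ is the improper integral from 0 to +oo. *)
Definition macdonald (R : realType) (z : R[i]) (x : R) : R[i] :=
  Cintegral `[0, +oo[
    (fun t => (expR (- x * coshR t))%:C * coshC (z * t%:C)).

(* Main.v *)
Require Import Defs.
From mathcomp Require Import all_boot all_order all_algebra.
From mathcomp Require Import all_classical all_reals all_analysis.
From mathcomp.real_closed Require Import complex.
From mathcomp Require Import measurable_realfun.
From mathcomp Require Import ring lra.

Set Implicit Arguments.
Unset Strict Implicit.
Unset Printing Implicit Defensive.

Import Order.TTheory GRing.Theory Num.Theory.
Import numFieldNormedType.Exports.
Local Open Scope classical_set_scope.
Local Open Scope ring_scope.
Local Open Scope complex_scope.

(** Write K_nu(x), nu = 1/2 + i tau, as half the integral over t >= 0 of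
    G(t) + G(-t) with G(w) = exp(-x cosh w + nu w). By Cauchy's theorem t may be
    replaced by t + i th for 0 <= th < pi/2, which gives
      |K_nu(x)| <= exp(-tau th) K_{1/2}(x cos th)
                <= exp(-tau th) sqrt(pi / (2 x cos th)).
    The best angle is th = atan T with T = 2 tau, and it remains to see that
    sinh(pi T / 2) <= (pi T / 2) E(T), where E(T) = exp(T atan T) cos(atan T).
    Since E' = E atan, the quotient sinh(pi T / 2) / (T E(T)) is nonincreasing
    as soon as (pi/2) coth(pi T / 2) <= 1/T + atan T; it tends to pi/2 at 0. *)

(** * Elementary inequalities *)

(** Mean value theorem. It is mostly applied to the difference of two functions that agree at 0,
    with the sign of the derivative needed only in the interior. *)
Lemma ler_is_derive (R : realType) (f df : R -> R) (a b : R) : a <= b ->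
  (forall t, a <= t <= b -> is_derive t 1 f (df t)) ->
  (forall t, a < t < b -> 0 <= df t) -> f a <= f b.
Proof.
rewrite le_eqVlt => /predU1P[->//|ab] df_ df0.
have /MVT : a < b by [].
move=> /(_ f df)[].
- by move=> t; rewrite in_itv/= => /andP[? ?]; apply: df_; rewrite !ltW.
- apply: derivable_within_continuous => t; rewrite in_itv/= => t_.
  by apply: ex_derive; apply: df_.
- move=> c; rewrite in_itv/= => cab /eqP.
  by rewrite subr_eq => /eqP ->; rewrite lerDr mulr_ge0// ?df0// subr_ge0 ltW.
Qed.

Lemma is_derive_sinhR (R : realType) (t : R) :
  is_derive t 1 (@sinhR R) (coshR t).
Proof.
rewrite /sinhR /coshR; apply: is_derive_eq.
by rewrite /GRing.scale/=; field.
Qed.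
#[global] Existing Instance is_derive_sinhR.

Lemma is_derive_coshR (R : realType) (t : R) :
  is_derive t 1 (@coshR R) (sinhR t).
Proof.
rewrite /sinhR /coshR; apply: is_derive_eq.
by rewrite /GRing.scale/=; field.
Qed.
#[global] Existing Instance is_derive_coshR.

Lemma sinhR0 (R : realType) : sinhR 0 = 0 :> R.
Proof. by rewrite /sinhR oppr0 subrr mul0r. Qed.

Lemma coshR0 (R : realType) : coshR 0 = 1 :> R.
Proof. by rewrite /coshR oppr0 expR0; field. Qed.

Lemma coshR_gt0 (R : realType) (t : R) : 0 < coshR t.
Proof. by rewrite divr_gt0// addr_gt0// expR_gt0. Qed.

Lemma sinhR_ge0 (R : realType) (t : R) : 0 <= t -> 0 <= sinhR t.
Proof. by move=> t0; rewrite divr_ge0// subr_ge0 ler_expR; lra. Qed.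

Lemma sinhR_gt0 (R : realType) (t : R) : 0 < t -> 0 < sinhR t.
Proof. by move=> t0; rewrite divr_gt0// subr_gt0 ltr_expR; lra. Qed.

Lemma sinhR_le_mul_coshR (R : realType) (t : R) : 0 <= t ->
  sinhR t <= t * coshR t.
Proof.
move=> t0; rewrite -subr_ge0.
have := @ler_is_derive R (fun t => t * coshR t - sinhR t)
  (fun t => t * sinhR t) 0 t t0.
rewrite mul0r sinhR0 subrr; apply.
  move=> s _; apply: is_derive_eq.
  by rewrite /GRing.scale/=; ring.
by move=> s /andP[s0 _]; rewrite mulr_ge0 ?sinhR_ge0// ltW.
Qed.

(** The difference of the two sides vanishes at 0 and has derivative t/3 (t cosh t - sinh t),
    nonnegative by the previous bound. *)
Lemma mul_coshR_le (R : realType) (t : R) : 0 <= t ->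
  t * coshR t <= (1 + t ^+ 2 / 3) * sinhR t.
Proof.
move=> t0; rewrite -subr_ge0.
have := @ler_is_derive R (fun t => (1 + t ^+ 2 / 3) * sinhR t - t * coshR t)
  (fun t => t / 3 * (t * coshR t - sinhR t)) 0 t t0.
rewrite mul0r sinhR0 mulr0 subrr; apply.
  move=> s _; apply: is_derive_eq.
  by rewrite /GRing.scale/=; field.
move=> s /andP[s0 _]; rewrite mulr_ge0//; first by rewrite divr_ge0// ltW.
by rewrite subr_ge0 sinhR_le_mul_coshR// ltW.
Qed.

(** The left side is the [1/2] Padé approximant of arctan at 0. Matching the Taylor series leaves
    the single term 4u^4 in the numerator of the derivative of the difference, so its sign is
    evident. *)
Lemma atan_ge_pade (R : realType) (u : R) : 0 <= u ->
  3 * u / (3 + u ^+ 2) <= atan u.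
Proof.
move=> u0; rewrite -subr_ge0.
have := @ler_is_derive R (fun u => atan u - 3 * u / (3 + u ^+ 2))
  (fun u => 4 * u ^+ 4 / ((1 + u ^+ 2) * (3 + u ^+ 2) ^+ 2)) 0 u u0.
rewrite atan0 mulr0 mul0r subrr; apply; last first.
  move=> s /andP[s0 _]; rewrite divr_ge0// ?mulr_ge0//;
    rewrite ?exprn_ge0 ?addr_ge0 ?exprn_ge0// ltW//.
move=> s /andP[s0 _].
have nz : 3 + s ^+ 2 != 0 by rewrite gt_eqF// ltr_wpDr// exprn_ge0.
have nz1 : 1 + s ^+ 2 != 0 by rewrite gt_eqF// ltr_wpDr// exprn_ge0.
(* The derivative of the reciprocal is supplied by hand, since it rests on the denominator being
   nonzero. *)
have dV : is_derive s 1 (fun s : R => (3 + s ^+ 2)^-1)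
    (- (3 + s ^+ 2) ^- 2 *: (2 * s)).
  apply: is_deriveV => //; apply: is_derive_eq.
  by rewrite /GRing.scale/=; ring.
apply: is_derive_eq.
by rewrite /GRing.scale/=; field; rewrite nz.
Qed.

(** Same argument with the [3/2] Padé approximant; the derivative of the difference now has
    numerator 36u^6. *)
Lemma atan_le_pade (R : realType) (u : R) : 0 <= u ->
  atan u <= u * (15 + 4 * u ^+ 2) / (15 + 9 * u ^+ 2).
Proof.
move=> u0; rewrite -subr_ge0.
have := @ler_is_derive R
  (fun u => u * (15 + 4 * u ^+ 2) / (15 + 9 * u ^+ 2) - atan u)
  (fun u => 36 * u ^+ 6 / ((1 + u ^+ 2) * (15 + 9 * u ^+ 2) ^+ 2)) 0 u u0.
rewrite atan0 !mul0r subrr; apply; last first.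
  move=> s /andP[s0 _]; rewrite divr_ge0// ?mulr_ge0//;
    rewrite ?exprn_ge0 ?addr_ge0 ?mulr_ge0 ?exprn_ge0// ltW//.
move=> s /andP[s0 _].
have nz : 15 + 9 * s ^+ 2 != 0.
  by rewrite gt_eqF// ltr_wpDr// mulr_ge0// exprn_ge0.
have nz1 : 1 + s ^+ 2 != 0 by rewrite gt_eqF// ltr_wpDr// exprn_ge0.
have dV : is_derive s 1 (fun s : R => (15 + 9 * s ^+ 2)^-1)
    (- (15 + 9 * s ^+ 2) ^- 2 *: (18 * s)).
  apply: is_deriveV => //; apply: is_derive_eq.
  by rewrite /GRing.scale/=; ring.
apply: is_derive_eq.
by rewrite /GRing.scale/=; field; rewrite nz.
Qed.

Lemma pi_ge3 (R : realType) : 3 <= pi :> R.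
Proof.
have := @atan_ge_pade R 1 ler01; rewrite atan1 expr1n.
by rewrite (_ : 3 * 1 / (3 + 1) = 3 / 4); [lra|field].
Qed.

Lemma pi_le_19_6 (R : realType) : pi <= 19 / 6 :> R.
Proof.
have := @atan_le_pade R 1 ler01; rewrite atan1 expr1n.
by rewrite (_ : 1 * (15 + 4 * 1) / (15 + 9 * 1) = 19 / 24); [lra|field].
Qed.

Lemma series_exp_coeff_le_expR (R : realType) (z : R) (n : nat) : 0 <= z ->
  series (exp_coeff z) n <= expR z.
Proof.
move=> z0; apply: nondecreasing_cvgn_le; last exact: is_cvg_series_exp_coeff.
by apply: nondecreasing_series => i _ _; rewrite divr_ge0// exprn_ge0.
Qed.

Lemma expR_ge_taylor5 (R : realType) (z : R) : 0 <= z ->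
  1 + z + z ^+ 2 / 2 + z ^+ 3 / 6 + z ^+ 4 / 24 + z ^+ 5 / 120 <= expR z.
Proof.
move=> z0; apply: le_trans (@series_exp_coeff_le_expR R z 6 z0).
rewrite seriesEnat/= big_mkord !big_ord_recr big_ord0/= /exp_coeff/= expr0.
by rewrite add0r !divr1 expr1.
Qed.

(** Both sides have the same tangent, because tan(pi/2 - a) = 1 / tan a. *)
Lemma atanV (R : realType) (u : R) : 0 < u -> atan u^-1 = pi / 2 - atan u.
Proof.
move=> u0; have au0 : 0 < atan u by rewrite -(@atan0 R) lt_atan.
have aupi := atan_ltpi2 u.
rewrite -{1}(atanK u) -[RHS]tanK ?in_itv/=; last by apply/andP; split; lra.
by congr atan; rewrite /tan -opprB cosN sinN cosBpihalf sinBpihalf opprK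
  invf_div.
Qed.

(* For T <= 3/4: z coth z <= 1 + z^2/3 and the lower Padé bound on atan T. For
   T > 3/4: the upper Padé bound on atan (1/T) and exp (pi T) - 1 >= its Taylor
   polynomial. Both ranges need only 3 <= pi <= 19/6, the Padé bounds at 1. *)
Lemma pihalf_coshR_le (R : realType) (T : R) : 0 < T ->
  pi / 2 * coshR (pi / 2 * T) <= (T^-1 + atan T) * sinhR (pi / 2 * T).
Proof.
move=> T0; have pi3 := @pi_ge3 R; have pi19 := @pi_le_19_6 R.
have Tn0 : T != 0 by rewrite gt_eqF.
set z := pi / 2 * T; have z0 : 0 < z by rewrite mulr_gt0//; lra.
have [T34|T34] := lerP T (3 / 4).
  have -> : pi / 2 * coshR z = T^-1 * (z * coshR z) by rewrite /z; field.
  apply: le_trans (_ : T^-1 * ((1 + z ^+ 2 / 3) * sinhR z) <= _).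
    by rewrite ler_wpM2l ?invr_ge0 ?mul_coshR_le// ltW.
  rewrite mulrA ler_wpM2r ?sinhR_ge0 ?(ltW z0)//.
  rewrite mulrDr mulr1 lerD2l (le_trans _ (@atan_ge_pade R _ (ltW T0)))//.
  have -> : T^-1 * (z ^+ 2 / 3) = T * (pi ^+ 2 / 12) by rewrite /z; field.
  rewrite (mulrC 3 T) -[leRHS]mulrA ler_wpM2l ?(ltW T0)//.
  rewrite ler_pdivlMr; last by nra.
  (* What remains is pi^2 (3 + T^2) <= 36. At the extreme values pi = 19/6 and T = 3/4 the left side
     is about 35.7. *)
  have : pi ^+ 2 <= (19 / 6) ^+ 2 :> R by rewrite ler_sqr// nnegrE; lra.
  have : T ^+ 2 <= (3 / 4) ^+ 2 by rewrite ler_sqr// nnegrE; lra.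
  have := sqr_ge0 T; have := sqr_ge0 (pi : R).
  by nra.
(* [s] is 1/T minus the upper Padé bound at 1/T, so that 1/T + atan T >= s + pi/2. *)
pose s := 5 / (T * (15 * T ^+ 2 + 9)).
have d0 : 0 < 15 * T ^+ 2 + 9 by nra.
have dn0 : 15 * T ^+ 2 + 9 != 0 by rewrite gt_eqF.
have s_le : s + pi / 2 <= T^-1 + atan T.
  have Ti0 : 0 < T^-1 by rewrite invr_gt0.
  have := @atan_le_pade R _ (ltW Ti0); rewrite atanV//.
  have -> : T^-1 * (15 + 4 * T^-1 ^+ 2) / (15 + 9 * T^-1 ^+ 2) = T^-1 - s.
    by rewrite /s; field; rewrite Tn0/= dn0.
  lra.
apply: (@le_trans _ _ ((s + pi / 2) * sinhR z)); last first.
  by rewrite ler_wpM2r ?sinhR_ge0 ?(ltW z0).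
(* As cosh z - sinh z = exp(-z), the claim becomes s (exp(2z) - 1) >= pi, where 2z = pi T. *)
rewrite [leRHS]mulrDl -lerBlDr -mulrBr.
have -> : coshR z - sinhR z = expR (- z) by rewrite /coshR /sinhR; field.
have -> : sinhR z = (expR (pi * T) - 1) * expR (- z) / 2.
  have -> : pi * T = z + z by rewrite /z; field.
  by rewrite mulrBl expRD -mulrA expRxMexpNx_1 mulr1 mul1r.
rewrite mulrAC [leRHS]mulrA ler_pM2r// [leRHS]mulrA ler_pM2r ?expR_gt0//.
rewrite /s mulrAC ler_pdivlMr ?mulr_gt0//.
have piT0 : 0 <= pi * T by rewrite mulr_ge0 ?pi_ge0 ?ltW.
have := @expR_ge_taylor5 R _ piT0; set w := pi * T => ew.
suff : w * (15 * T ^+ 2 + 9) <=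
  5 * (w + w ^+ 2 / 2 + w ^+ 3 / 6 + w ^+ 4 / 24 + w ^+ 5 / 120).
  have -> : w * (15 * T ^+ 2 + 9) =
    pi * (T * (15 * T ^+ 2 + 9)) by rewrite mulrA.
  lra.
have -> : w + w ^+ 2 / 2 + w ^+ 3 / 6 + w ^+ 4 / 24 + w ^+ 5 / 120 =
  w * (1 + w / 2 + w ^+ 2 / 6 + w ^+ 3 / 24 + w ^+ 4 / 120) by field.
rewrite [leRHS]mulrCA ler_wpM2l//.
(* Bounding 15 T^2 by 5 w^2 / 3 leaves a polynomial inequality in w alone. Expanded around 9/4, the
   difference of its sides has only positive coefficients in d = w - 9/4, so linear arithmetic over
   the powers of d suffices. *)
have w9 : 9 / 4 <= w by rewrite /w; nra.
have w2 : 9 * T ^+ 2 <= w ^+ 2 by rewrite exprMn ler_wpM2r ?sqr_ge0//; nra.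
have [d d_ge0 wE] : exists2 d, 0 <= d & w = 9 / 4 + d.
  by exists (w - 9 / 4); [rewrite subr_ge0|rewrite addrC subrK].
have d2 : 0 <= d ^+ 2 by rewrite exprn_ge0.
have d3 : 0 <= d ^+ 3 by rewrite exprn_ge0.
have d4 : 0 <= d ^+ 4 by rewrite exprn_ge0.
by rewrite wE in w2 *; lra.
Qed.

Lemma is_derive_continuous (R : realType) (f df : R -> R) :
  (forall t : R, is_derive t 1 f (df t)) -> continuous f.
Proof.
move=> d t; apply: differentiable_continuous.
by apply/derivable1_diffP; exact: ex_derive.
Qed.

(** * The gain at the optimal angle *)

Lemma cos_atan_gt0 (R : realType) (T : R) : 0 < cos (atan T).
Proof. by rewrite cos_gt0_pihalf// atan_gtNpi2 atan_ltpi2. Qed.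

Lemma sin_atan (R : realType) (T : R) : sin (atan T) = T * cos (atan T).
Proof. by rewrite -{2}(atanK T) /tan mulfVK// gt_eqF// cos_atan_gt0. Qed.

(** This is E(T), the maximum of exp(T th) cos th over |th| < pi/2, attained at tan th = T. For T =
    2 tau its power -1/2 is the factor exp(-tau th) / sqrt(cos th) of the shifted bound. *)
Definition shift_gain (R : realType) (T : R) : R :=
  expR (T * atan T) * cos (atan T).

Lemma shift_gain_gt0 (R : realType) (T : R) : 0 < shift_gain T.
Proof. by rewrite mulr_gt0 ?expR_gt0 ?cos_atan_gt0. Qed.

(** The terms coming from the motion of the angle cancel by sin(atan T) = T cos(atan T), as they
    must at a stationary angle. *)
Lemma is_derive_shift_gain (R : realType) (T : R) :
  is_derive T 1 (@shift_gain R) (shift_gain T * atan T).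
Proof.
rewrite /shift_gain; apply: is_derive_eq.
rewrite /GRing.scale/= sin_atan; field.
by rewrite gt_eqF// ltr_wpDr// exprn_even_ge0.
Qed.
#[global] Existing Instance is_derive_shift_gain.

Lemma shift_gain_ge1 (R : realType) (T : R) : 0 <= T -> 1 <= shift_gain T.
Proof.
move=> T0.
have := @ler_is_derive R (@shift_gain R)
  (fun T => shift_gain T * atan T) 0 T T0.
have -> : shift_gain 0 = 1 :> R.
  by rewrite /shift_gain atan0 mulr0 expR0 cos0 mulr1.
apply.
move=> s /andP[s0 _]; rewrite mulr_ge0 ?(ltW (shift_gain_gt0 _))//.
by rewrite -(@atan0 R) le_atan// ltW.
Qed.

Lemma sinhR_pihalf_le_shift_gain (R : realType) (T : R) : 0 < T ->
  sinhR (pi / 2 * T) <= pi / 2 * T * shift_gain T.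
Proof.
move=> T0.
(* The quotient is negated so that it becomes nondecreasing. *)
pose g (t : R) := - (sinhR (pi / 2 * t) * (t * shift_gain t)^-1).
pose dg (t : R) := ((t^-1 + atan t) * sinhR (pi / 2 * t)
   - pi / 2 * coshR (pi / 2 * t)) * (t * shift_gain t)^-1.
have g_le (s : R) : 0 < s -> s <= T -> g s <= g T.
  move=> s0 sT.
  have dgE t : s <= t <= T -> is_derive t 1 g (dg t).
    move=> /andP[st _]; have t0 := lt_le_trans s0 st.
    have E0 := shift_gain_gt0 t.
    have nz : t * shift_gain t != 0 by rewrite gt_eqF// mulr_gt0.
    have dV : is_derive t 1 (fun t : R => (t * shift_gain t)^-1)
       (- (t * shift_gain t) ^- 2 *: (shift_gain t * (1 + t * atan t))).
      apply: is_deriveV => //; apply: is_derive_eq.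
      by rewrite /GRing.scale/=; ring.
    rewrite /g /dg; apply: is_derive_eq.
    by rewrite /GRing.scale/=; field; rewrite !gt_eqF.
  apply (ler_is_derive sT dgE) => t /andP[st _]; have t0 := lt_trans s0 st.
  by rewrite mulr_ge0 ?subr_ge0 ?pihalf_coshR_le// invr_ge0 ltW// mulr_gt0//
    shift_gain_gt0.
(* The limit of the quotient at 0 is not computed: sinh u <= u cosh u and E >= 1 bound the quotient
   at s by a continuous function with value pi/2 at 0, and s then tends to 0 from the right. *)
have gT (s : R) : 0 < s -> s <= T -> - g T <= pi / 2 * coshR (pi / 2 * s).
  move=> s0 sT; apply: (@le_trans _ _ (- g s)); first by rewrite lerN2 g_le.
  rewrite /g opprK ler_pdivrMr; last by rewrite mulr_gt0 ?shift_gain_gt0.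
  have ps0 : 0 <= pi / 2 * s by rewrite mulr_ge0 ?ltW// divr_gt0 ?pi_gt0.
  apply: le_trans (@sinhR_le_mul_coshR _ _ ps0) _.
  rewrite mulrAC ler_wpM2l//; last by rewrite ler_peMr ?shift_gain_ge1 ?ltW.
  by rewrite mulr_ge0 ?(ltW (coshR_gt0 _))// divr_ge0 ?pi_ge0.
have F0 : pi / 2 * coshR (pi / 2 * s) @[s --> (0:R)^'+] -->
    pi / 2 * coshR (pi / 2 * 0).
  apply: cvg_at_right_filter.
  have cF : continuous (fun s : R => pi / 2 * coshR (pi / 2 * s)).
    apply: (@is_derive_continuous R _
      (fun s => pi / 2 * (pi / 2 * sinhR (pi / 2 * s)))) => t.
    by apply: is_derive_eq; rewrite /GRing.scale/=; ring.
  exact: cF.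
have : - g T <= pi / 2.
  rewrite mulr0 coshR0 mulr1 in F0.
  apply: (cvgr_to_ge F0); near=> r; apply: gT; near: r.
    exact: nbhs_right_gt.
  exact: nbhs_right_le.
by rewrite /g opprK ler_pdivrMr ?(mulr_gt0 T0 (shift_gain_gt0 _))// mulrA.
Unshelve. all: by end_near. Qed.

(** * Improper integrals over the half line *)

(** For a nonnegative integrand the fundamental theorem holds in the extended reals; finiteness of
    the limit [l] then gives integrability along with the value. *)
Lemma Rintegral_FTC2y (R : realType) (f F : R -> R) (l : R) :
  (forall t, 0 <= t -> 0 <= f t) -> continuous f ->
  (forall t : R, is_derive t 1 F (f t)) -> F t @[t --> +oo] --> l ->
  \int[lebesgue_measure]_(t in `[0%R, +oo[) f t = l - F 0 /\
  lebesgue_measure.-integrable `[0%R, +oo[ (EFin \o f).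
Proof.
move=> f0 cf dF Fl.
have H : (\int[lebesgue_measure]_(t in `[0%R, +oo[) (f t)%:E =
  l%:E - (F 0)%:E)%E.
  apply: (@ge0_continuous_FTC2y R f F 0 l) => //.
  - by apply: continuous_subspaceT => t; exact: cf.
  - by apply: cvg_at_right_filter; apply: (is_derive_continuous dF).
  - by move=> t _; rewrite derive1E derive_val.
split; first by rewrite /Rintegral H.
apply/integrableP; split.
  by apply/measurable_EFinP; apply: measurable_funTS;
    exact: continuous_measurable_fun.
under eq_integral.
  move=> t; rewrite inE/= in_itv/= andbT => t0.
  by rewrite ger0_norm ?f0//; over.
by rewrite H -EFinB ltry.
Qed.

Lemma Rintegral_expRN (R : realType) (K : R) : 0 <= K ->
  \int[lebesgue_measure]_(t in `[0%R, +oo[) (K * expR (- t)) = K /\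
  lebesgue_measure.-integrable `[0%R, +oo[
    (EFin \o (fun t : R => K * expR (- t))).
Proof.
move=> K0.
have := @Rintegral_FTC2y R (fun t => K * expR (- t))
  (fun t => - (K * expR (- t))) 0.
rewrite oppr0 expR0 mulr1 sub0r opprK; apply.
- by move=> t _; rewrite mulr_ge0 ?expR_ge0.
- apply: (@is_derive_continuous R _ (fun t => - (K * expR (- t)))) => t.
  by apply: is_derive_eq; rewrite /GRing.scale/=; ring.
- by move=> t; apply: is_derive_eq; rewrite /GRing.scale/=; ring.
- rewrite -oppr0; apply: cvgN; rewrite -(mulr0 K).
  by apply: cvgM; [exact: cvg_cst|exact: cvgr_expR].
Qed.

Lemma integrable_expRN_dominated (R : realType) (f : R -> R) (K : R) :
  continuous f -> (forall t, 0 <= t -> `|f t| <= K * expR (- t)) ->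
  lebesgue_measure.-integrable `[0%R, +oo[ (EFin \o f).
Proof.
move=> cf fK.
have K0 : 0 <= K.
  by have := le_trans (normr_ge0 _) (fK 0 (lexx _)); rewrite oppr0 expR0 mulr1.
apply: (le_integrable _ _ _ (Rintegral_expRN K0).2) => //.
  by apply/measurable_EFinP; apply: measurable_funTS;
    exact: continuous_measurable_fun.
move=> t /=; rewrite in_itv/= andbT => t0.
by rewrite lee_fin [leRHS]ger0_norm ?fK// mulr_ge0// expR_ge0.
Qed.

(* The sign condition of the library's half-line fundamental theorem is met
   after adding K exp(-t) to the integrand. *)
Lemma Rintegral_FTC2y_dominated (R : realType) (f F : R -> R) (K : R) :
  continuous f -> (forall t : R, is_derive t 1 F (f t)) ->
  (forall t, 0 <= t -> `|f t| <= K * expR (- t)) ->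
  (forall t, 0 <= t -> `|F t| <= K * expR (- t)) ->
  \int[lebesgue_measure]_(t in `[0%R, +oo[) f t = - F 0.
Proof.
move=> cf dF fK FK.
have K0 : 0 <= K.
  by have := le_trans (normr_ge0 _) (fK 0 (lexx _)); rewrite oppr0 expR0 mulr1.
have [IK iK] := Rintegral_expRN K0.
have cK : continuous (fun t => K * expR (- t)).
  apply: (@is_derive_continuous R _ (fun t => - (K * expR (- t)))) => t.
  by apply: is_derive_eq; rewrite /GRing.scale/=; ring.
have K_cvg : K * expR (- t) @[t --> +oo] --> 0.
  rewrite -(mulr0 K).
  by apply: cvgM; [exact: cvg_cst|exact: cvgr_expR].
have F_cvg : F t @[t --> +oo] --> 0.
  apply: norm_cvg0; apply: squeeze_cvgr K_cvg; last exact: (cvg_cst (0 : R)).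
  by near=> t; rewrite normr_ge0 FK//; near: t; exact: nbhs_pinfty_ge.
have [] := @Rintegral_FTC2y R (fun t => f t + K * expR (- t))
  (fun t => F t - K * expR (- t)) 0.
- move=> t t0; rewrite -lerBlDr sub0r.
  by have := fK _ t0; rewrite ler_norml => /andP[].
- by move=> t; apply: cvgD; [exact: cf|exact: cK].
- by move=> t; apply: is_derive_eq; rewrite /GRing.scale/=; ring.
- by rewrite -(subrr 0); apply: cvgB.
rewrite RintegralD//; last exact: integrable_expRN_dominated fK.
rewrite IK oppr0 expR0 mulr1 sub0r opprB addrC => /eqP.
by rewrite eq_sym subr_eq => /eqP; lra.
Unshelve. all: by end_near. Qed.

(** * Shifting the contour *)

(* Real part of exp(ic) exp(-x cosh w + (1/2 + i tau) w) at w = t + i th; its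
   harmonic conjugate is obtained by decreasing the phase c by pi / 2. *)
Definition wave (R : realType) (x tau c th t : R) : R :=
  expR (- (x * cos th * coshR t) + t / 2 - tau * th) *
  cos (- (x * sin th * sinhR t) + th / 2 + tau * t + c).

Definition dwave (R : realType) (x tau c th t : R) : R :=
  expR (- (x * cos th * coshR t) + t / 2 - tau * th) *
  ((2^-1 - x * cos th * sinhR t) *
     cos (- (x * sin th * sinhR t) + th / 2 + tau * t + c) -
   (tau - x * sin th * coshR t) *
     sin (- (x * sin th * sinhR t) + th / 2 + tau * t + c)).

Lemma is_derive_wave_time (R : realType) (x tau c th t : R) :
  is_derive t 1 (wave x tau c th) (dwave x tau c th t).
Proof.
rewrite /wave /dwave; apply: is_derive_eq.
by rewrite /GRing.scale/=; field.
Qed.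

(** A Cauchy-Riemann equation: the th-derivative of the real part is minus the t-derivative of the
    imaginary part, which is the wave of phase c - pi/2. *)
Lemma is_derive_wave_angle (R : realType) (x tau c th t : R) :
  is_derive th 1 (fun th => wave x tau c th t)
    (- dwave x tau (c - pi / 2) th t).
Proof.
rewrite /wave /dwave !addrA cosBpihalf sinBpihalf; apply: is_derive_eq.
by rewrite /GRing.scale/=; field.
Qed.

Lemma dwave_continuous (R : realType) (x tau c th : R) :
  continuous (dwave x tau c th).
Proof.
have d (t : R) : derivable (dwave x tau c th) t 1.
  by apply: ex_derive.
by move=> t; apply: differentiable_continuous; apply/derivable1_diffP.
Qed.

(** * Decay and integrability of the waves *)

Lemma coshRN (R : realType) (t : R) : coshR (- t) = coshR t.
Proof. by rewrite /coshR opprK addrC. Qed.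

Lemma coshR_norm (R : realType) (t : R) : coshR `|t| = coshR t.
Proof. by have [t0|t0] := ger0P t; rewrite ?coshRN. Qed.

Lemma normr_sinhR_le (R : realType) (t : R) : `|sinhR t| <= coshR t.
Proof.
have := expR_ge0 t; have := expR_ge0 (- t).
by rewrite ler_norml /sinhR /coshR => ? ?; apply/andP; split; lra.
Qed.

Lemma coshR_le (R : realType) (t : R) : coshR t <= expR `|t|.
Proof.
rewrite -coshR_norm /coshR.
suff : expR (- `|t|) <= expR `|t| by lra.
by rewrite ler_expR; have := normr_ge0 t; lra.
Qed.

(** With y = (b/2) exp|t| <= b cosh t, the bound exp(-y) <= 3!/y^3 gives decay exp(-3|t|), enough to
    absorb exp(3|t|/2) and leave exp(-|t|). The factor exp|t| on the left makes room for the
    hyperbolic functions in [dwave]. *)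
Lemma expR_coshR_decay (R : realType) (b t : R) : 0 < b ->
  expR (- (b * coshR t) + `|t| / 2) * expR `|t| <=
  48 / b ^+ 3 * expR (- `|t|).
Proof.
move=> b0; set a := `|t|; have a0 : 0 <= a by exact: normr_ge0.
set y := b / 2 * expR a.
have y0 : 0 < y by rewrite mulr_gt0 ?expR_gt0 ?divr_gt0.
have yle : y <= b * coshR t.
  have -> : y = b * (expR a / 2) by rewrite /y; field.
  rewrite -(coshR_norm t) -/a ler_wpM2l ?(ltW b0)//.
  by rewrite /coshR; have := expR_ge0 (- a); lra.
have ey : expR (- y) <= 6 / y ^+ 3.
  rewrite expRN -[leRHS]invf_div lef_pV2 ?posrE ?expR_gt0 ?divr_gt0
    ?exprn_gt0//.
  apply: le_trans (expR_ge1Dxn 2 (ltW y0)).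
  by rewrite lerDr.
have Ey : 6 / y ^+ 3 = 48 / b ^+ 3 * expR (- (3 * a)).
  by rewrite expRN (@expRM_natl _ 3) /y; field; rewrite ?gt_eqF ?expR_gt0.
rewrite -expRD; apply: (@le_trans _ _ (expR (- y) * expR (3 / 2 * a))).
  by rewrite -expRD ler_expR; lra.
apply: (@le_trans _ _ (6 / y ^+ 3 * expR (3 / 2 * a))).
  by rewrite ler_wpM2r ?expR_ge0.
rewrite Ey -mulrA -expRD ler_wpM2l//.
  by rewrite divr_ge0// exprn_ge0// ltW.
by rewrite ler_expR; lra.
Qed.

(** One constant serves all angles with cos th >= r, as differentiation under the integral requires.
    Both signs of t are covered because the integrands combine t and -t; the limit 2 on |th| is a
    convenient bound above pi/2. *)
Lemma wave_dominated (R : realType) (x tau c r : R) :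
  0 < x -> 0 <= tau -> 0 < r ->
  exists K : R, forall th, r <= cos th -> `|th| <= 2 -> forall t,
    `|wave x tau c th t| <= K * expR (- `|t|) /\
    `|dwave x tau c th t| <= K * expR (- `|t|).
Proof.
move=> x0 tau0 r0; pose b := x * r.
have b0 : 0 < b by rewrite mulr_gt0.
(* [A] exp|t| bounds the prefactor 1/2 + tau + 2x exp|t| of [dwave]; the factor exp(2 tau) in the
   constant comes from |th| <= 2. *)
pose A := 1 + tau + 2 * x.
have A1 : 1 <= A by rewrite /A; lra.
exists (expR (2 * tau) * A * (48 / b ^+ 3)) => th rth th2 t.
set P := - (x * cos th * coshR t) + t / 2 - tau * th.
set Q := - (x * sin th * sinhR t) + th / 2 + tau * t + c.
have C1 := coshR_le t; have C0 := coshR_gt0 t.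
have S1 := le_trans (normr_sinhR_le t) C1.
have e1 : 1 <= expR `|t| by rewrite -expR0 ler_expR.
have PE : expR P <= expR (2 * tau) * expR (- (b * coshR t) + `|t| / 2).
  rewrite -expRD ler_expR /P.
  have : b * coshR t <= x * cos th * coshR t.
    by rewrite ler_wpM2r ?(ltW C0)// /b ler_wpM2l// ltW.
  have := ler_norm t.
  have : - (tau * th) <= 2 * tau.
    by rewrite -mulrN mulrC ler_wpM2r// (le_trans (ler_norm _))// normrN.
  lra.
have PA : expR P * (A * expR `|t|) <=
    expR (2 * tau) * A * (48 / b ^+ 3) * expR (- `|t|).
  have D := expR_coshR_decay t b0.
  pose B := expR (- (b * coshR t) + `|t| / 2).
  apply: (@le_trans _ _ (expR (2 * tau) * B * (A * expR `|t|))).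
    by rewrite ler_wpM2r// mulr_ge0 ?expR_ge0//; lra.
  have -> : expR (2 * tau) * B * (A * expR `|t|) =
    expR (2 * tau) * A * (B * expR `|t|) by ring.
  rewrite -[leRHS]mulrA ler_wpM2l// mulr_ge0 ?expR_ge0//; lra.
have cosQ : `|cos Q| <= 1 by rewrite ler_norml cos_geN1 cos_le1.
have sinQ : `|sin Q| <= 1 by rewrite ler_norml sin_geN1 sin_le1.
have costh : `|cos th| <= 1 by rewrite ler_norml cos_geN1 cos_le1.
have sinth : `|sin th| <= 1 by rewrite ler_norml sin_geN1 sin_le1.
split; apply: le_trans PA;
  rewrite normrM (ger0_norm (expR_ge0 _)) ler_wpM2l ?expR_ge0//.
  by rewrite (le_trans cosQ)// -[leLHS]mulr1 ler_pM.
have B1 : `|2^-1 - x * cos th * sinhR t| <= 2^-1 + x * expR `|t|.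
  apply: le_trans (ler_normB _ _) _.
  rewrite [X in X + _]ger0_norm ?invr_ge0//
    lerD2l (normrM (x * _)) (normrM x) (gtr0_norm x0).
  by rewrite -mulrA ler_wpM2l ?(ltW x0)// -[leRHS]mul1r ler_pM.
have B2 : `|tau - x * sin th * coshR t| <= tau + x * expR `|t|.
  apply: le_trans (ler_normB _ _) _.
  rewrite [X in X + _]ger0_norm//
    lerD2l (normrM (x * _)) (normrM x) (gtr0_norm x0) (gtr0_norm C0).
  by rewrite -mulrA ler_wpM2l ?(ltW x0)// -[leRHS]mul1r ler_pM// ltW.
apply: (@le_trans _ _ ((2^-1 + x * expR `|t|) * 1 + (tau + x * expR `|t|) * 1)).
  by apply: le_trans (ler_normB _ _) _; rewrite lerD// normrM ler_pM.
rewrite !mulr1 /A; nra.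
Qed.

Lemma ler_cos_norm (R : realType) (a th : R) :
  0 <= a <= pi -> `|th| <= a -> cos a <= cos th.
Proof.
move=> /andP[a0 api] tha.
have -> : cos th = cos `|th| by have [|] := ger0P th; rewrite ?cosN.
have [->//|ne] := eqVneq `|th| a.
rewrite ltW// ltr_cos ?lt_neqAle ?ne// in_itv/= ?a0//.
by rewrite normr_ge0 (le_trans tha).
Qed.

Lemma wave_integrable (R : realType) (x tau c th : R) :
  0 < x -> 0 <= tau -> `|th| < pi / 2 ->
  lebesgue_measure.-integrable `[0%R, +oo[
    (EFin \o (fun t => wave x tau c th t + wave x tau c th (- t))).
Proof.
move=> x0 tau0 thpi.
have cth : 0 < cos th by rewrite cos_gt0_pihalf// -ltr_norml.
have [K KP] := wave_dominated c x0 tau0 cth.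
have th2 : `|th| <= 2 by rewrite ltW// (lt_trans thpi)// pihalf_lt2.
apply: (@integrable_expRN_dominated _ _ (2 * K)).
  apply: (@is_derive_continuous _ _
    (fun t => dwave x tau c th t - dwave x tau c th (- t))) => t.
  have ? := @is_derive_wave_time R x tau c th.
  by apply: is_derive_eq; rewrite /GRing.scale/=; ring.
move=> t t0; rewrite (le_trans (ler_normD _ _))//.
have [+ _] := KP _ (lexx _) th2 t; have [+ _] := KP _ (lexx _) th2 (- t).
by rewrite normrN (ger0_norm t0); lra.
Qed.

(* Cauchy's theorem on a half strip, in the form d/dth = i d/dt: the
   th-derivative of the integral is the boundary term at t = 0, which vanishes
   by symmetry. *)
Lemma Rintegral_wave_shift (R : realType) (x tau c th : R) :
  0 < x -> 0 <= tau -> 0 < th < pi / 2 ->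
  \int[lebesgue_measure]_(t in `[0%R, +oo[)
    (wave x tau c 0 t + wave x tau c 0 (- t)) =
  \int[lebesgue_measure]_(t in `[0%R, +oo[)
    (wave x tau c th t + wave x tau c th (- t)).
Proof.
move=> x0 tau0 /andP[th0 thpi].
(* A midpoint: ]-th1, th1[ is an open neighbourhood of [0, th] on which the cosine stays at least
   cos th1 > 0. The majorant is taken at phase c - pi/2, the phase of the angle derivative. *)
pose th1 := (th + pi / 2) / 2.
have th1_gt : th < th1 by rewrite /th1; lra.
have th1_lt : th1 < pi / 2 by rewrite /th1; lra.
have cth1 : 0 < cos th1 by rewrite cos_gt0_pihalf//; apply/andP; split; lra.
have [K KP] := wave_dominated (c - pi / 2) x0 tau0 cth1.
have in_th1 a : - th1 < a < th1 ->
    [/\ cos th1 <= cos a, `|a| <= 2 & `|a| < pi / 2].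
  rewrite -ltr_norml => ath1; split.
  - rewrite ler_cos_norm ?(ltW ath1)//.
    by apply/andP; split; have := @pi_ge0 R; lra.
  - by have := @pihalf_lt2 R; lra.
  - exact: lt_trans th1_lt.
pose f (a t : R) := wave x tau c a t + wave x tau c a (- t).
pose df (a t : R) :=
  - (dwave x tau (c - pi / 2) a t + dwave x tau (c - pi / 2) a (- t)).
have dfE (a t : R) : is_derive a 1 (f ^~ t) (df a t).
  have ? := @is_derive_wave_angle R x tau c a.
  by apply: is_derive_eq; rewrite /df opprD.
pose F a := \int[lebesgue_measure]_(t in `[0%R, +oo[) f a t.
have intf a : `]- th1, th1[%classic a ->
    lebesgue_measure.-integrable `[0%R, +oo[ (EFin \o f a).
  by rewrite /= in_itv/= => /in_th1[_ _ ?]; exact: wave_integrable.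
have derf (a t : R) : `]- th1, th1[%classic a -> `[0%R, +oo[%classic t ->
    derivable (f ^~ t) a 1.
  by move=> _ _; exact: ex_derive.
have K0 : 0 <= K.
  have := KP _ (lexx _); have th1_2 : `|th1| <= 2.
    by rewrite ger0_norm; have := @pihalf_lt2 R; lra.
  move=> /(_ th1_2 0)[+ _]; rewrite normr0 oppr0 expR0 mulr1.
  exact: le_trans.
have df_bound a t : - th1 < a < th1 -> 0 <= t ->
    `|df a t| <= 2 * K * expR (- t).
  move=> /in_th1[ca a2 _] t0.
  rewrite /df normrN (le_trans (ler_normD _ _))//.
  have [_ +] := KP _ ca a2 t; have [_ +] := KP _ ca a2 (- t).
  by rewrite normrN (ger0_norm t0); lra.
have G_ge0 (t : R) : 0 <= 2 * K * expR (- t).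
  by rewrite mulr_ge0 ?expR_ge0// mulr_ge0.
have intG := (@Rintegral_expRN R (2 * K) (mulr_ge0 (ler0n _ 2) K0)).2.
have partialE (a t : R) : partial1of2 f a t = df a t.
  by rewrite partial1of2E derive_val.
have G_ub (a t : R) : `]- th1, th1[%classic a -> `[0%R, +oo[%classic t ->
    `|partial1of2 f a t| <= 2 * K * expR (- t).
  rewrite /= !in_itv/= andbT => aI t0.
  by rewrite partialE df_bound.
have int_df a : - th1 < a < th1 ->
    \int[lebesgue_measure]_(t in `[0%R, +oo[) partial1of2 f a t = 0.
  move=> aI; under eq_Rintegral do rewrite partialE.
  (* [V] is a primitive in t of the angle derivative; it is odd, so its boundary value at 0
     vanishes. *)
  pose V (t : R) :=
    - (wave x tau (c - pi / 2) a t - wave x tau (c - pi / 2) a (- t)).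
  have V0 : - V 0 = 0 by rewrite /V oppr0 subrr !oppr0.
  rewrite -[RHS]V0.
  have cdf : continuous (df a).
    move=> t; rewrite /df; apply: cvgN; apply: cvgD;
      first exact: dwave_continuous.
    apply: (@continuous_comp _ _ _ -%R (dwave x tau (c - pi / 2) a)).
      exact: opp_continuous.
    exact: dwave_continuous.
  have dV (t : R) : is_derive t 1 V (df a t).
    clear dfE. (* otherwise it diverts the inference of derivatives below *)
    have ? := @is_derive_wave_time R x tau (c - pi / 2) a.
    by rewrite /V /df; apply: is_derive_eq; rewrite /GRing.scale/=; ring.
  have V_bound t : 0 <= t -> `|V t| <= 2 * K * expR (- t).
    move=> t0; have [ca a2 _] := in_th1 _ aI.
    rewrite /V normrN (le_trans (ler_normB _ _))//.
    have [+ _] := KP _ ca a2 t; have [+ _] := KP _ ca a2 (- t).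
    by rewrite normrN (ger0_norm t0); lra.
  exact (Rintegral_FTC2y_dominated cdf dV (fun t => df_bound a t aI) V_bound).
have dF a : - th1 < a < th1 -> is_derive a 1 F 0.
  move=> aI'; have aI : `]- th1, th1[%classic a by rewrite /= in_itv.
  split.
    exact: (@derivable_under_integral R _ _ lebesgue_measure f `[0%R, +oo[ _
      a (- th1) th1 aI intf derf _ G_ge0 intG G_ub).
  rewrite -derive1E.
  rewrite (@differentiation_under_integral R _ _ lebesgue_measure f `[0%R, +oo[
    _ a (- th1) th1 aI intf derf _ G_ge0 intG G_ub)//.
  exact: int_df.
(* [F] has zero derivative on [0, th], so its values at 0 and th coincide. *)
have [] := @MVT R F (cst 0) 0 th th0.
- by move=> a; rewrite in_itv/= => /andP[? ?]; apply: dF;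
    apply/andP; split; lra.
- apply: derivable_within_continuous => a; rewrite in_itv/= => /andP[? ?].
  have aI : - th1 < a < th1 by apply/andP; split; lra.
  by have ? := dF _ aI; exact: ex_derive.
by move=> a _ /eqP; rewrite /= mul0r subr_eq0 => /eqP/esym.
Qed.

(** * The Gaussian bound *)

(** Square root of the known limit pi/4 of the squared integral. *)
Lemma cvg_Rintegral0_gauss (R : realType) :
  \int[lebesgue_measure]_(t in `[0, y]) gauss_fun t @[y --> +oo] -->
    (Num.sqrt pi / 2 : R).
Proof.
have -> : Num.sqrt pi / 2 = Num.sqrt (pi / 4) :> R.
  rewrite sqrtrM ?pi_ge0// sqrtrV// (_ : 4 = 2 ^+ 2); last by rewrite -natrX.
  by rewrite sqrtr_sqr ger0_norm.
have -> : (fun y : R => \int[lebesgue_measure]_(t in `[0, y]) gauss_fun t) =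
    (fun y => Num.sqrt (gauss_integral_proof.integral0_gauss y ^+ 2)).
  apply/funext => y; rewrite sqrtr_sqr ger0_norm//.
  exact: gauss_integral_proof.integral0_gauss_ge0.
apply: continuous_cvg; first exact: sqrt_continuous.
exact: gauss_integral_proof.cvg_integral0_gauss_sqr.
Qed.

(** Starting at minus infinity gives a primitive differentiable on the whole line, in particular at
    0. *)
Definition gauss_primitive (R : realType) (y : R) : R :=
  \int[lebesgue_measure]_(t in `]-oo, y]) gauss_fun t.

Lemma integrable_gauss_ray (R : realType) (y : R) :
  lebesgue_measure.-integrable `]-oo, y] (EFin \o (@gauss_fun R)).
Proof. exact: (integrableS _ _ _ (@integrableT_gauss R)). Qed.

Lemma is_derive_gauss_primitive (R : realType) (y : R) :
  is_derive y 1 (@gauss_primitive R) (gauss_fun y).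
Proof.
(* The endpoint y + 1 puts y in the interior of the ray. *)
have y1 : y < y + 1 by rewrite ltrDl.
have [] := continuous_FTC1 y1 (@integrable_gauss_ray R (y + 1)) (ltNyr y)
  (@continuous_gauss_fun R y).
by rewrite derive1E => ? <-; exact: derivableP.
Qed.

Lemma gauss_primitive_cvg (R : realType) :
  gauss_primitive y @[y --> +oo] --> gauss_primitive (0 : R) + Num.sqrt pi / 2.
Proof.
have H : gauss_primitive (0 : R) +
    \int[lebesgue_measure]_(t in `[0, y]) gauss_fun t
    @[y --> +oo] --> gauss_primitive (0 : R) + Num.sqrt pi / 2.
  by apply: cvgD; [exact: cvg_cst|exact: cvg_Rintegral0_gauss].
apply: cvg_trans H; apply: near_eq_cvg; near=> y.
have y0 : 0 <= y by near: y; exact: nbhs_pinfty_ge.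
have := @Rintegral_itvB R (@gauss_fun R) -oo%O (BRight y) 0
  (integrable_gauss_ray y) isT.
rewrite bnd_simp => /(_ y0) E.
rewrite -Rintegral_itv_obnd_cbnd; last first.
  exact: (integrableS _ _ _ (@integrableT_gauss R)).
by rewrite -E /gauss_primitive addrC subrK.
Unshelve. all: by end_near. Qed.

Lemma coshR_half (R : realType) (t : R) : coshR t = 1 + 2 * sinhR (t / 2) ^+ 2.
Proof.
have E := expRxMexpNx_1 (t / 2).
have -> : coshR t = (expR (t / 2) ^+ 2 + expR (- (t / 2)) ^+ 2) / 2.
  by rewrite /coshR -!(@expRM_natl _ 2); congr ((expR _ + expR _) / 2); field.
have -> : 2 * sinhR (t / 2) ^+ 2 =
  (expR (t / 2) ^+ 2 + expR (- (t / 2)) ^+ 2) / 2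
     - expR (t / 2) * expR (- (t / 2)).
  by rewrite /sinhR; field.
by rewrite E [RHS]addrC subrK.
Qed.

Lemma coshR_ge1 (R : realType) (t : R) : 1 <= coshR t.
Proof. by rewrite coshR_half lerDl mulr_ge0// sqr_ge0. Qed.

Lemma sinhR_ge_id (R : realType) (t : R) : 0 <= t -> t <= sinhR t.
Proof.
move=> t0; rewrite -subr_ge0.
have := @ler_is_derive R (fun t => sinhR t - t) (fun t => coshR t - 1) 0 t t0.
rewrite sinhR0 subrr; apply.
by move=> s _; rewrite subr_ge0 coshR_ge1.
Qed.

(** Substitution s = sqrt(2b) sinh(t/2), for which b cosh t = b + s^2; the prefactor is normalised
    by sqrt(2/b) sqrt(2b) = 2. *)
Lemma is_derive_gauss_sinhR (R : realType) (b t : R) : 0 < b ->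
  is_derive t 1 (fun t => expR (- b) * Num.sqrt (2 / b) *
      gauss_primitive (Num.sqrt (2 * b) * sinhR (t / 2)))
    (expR (- (b * coshR t)) * coshR (t / 2)).
Proof.
move=> b0; have ? := @is_derive_gauss_primitive R.
apply: is_derive_eq; rewrite /GRing.scale/=.
have -> : expR (- (b * coshR t)) =
    expR (- b) * gauss_fun (Num.sqrt (2 * b) * sinhR (t / 2)).
  rewrite /gauss_fun -expRD; congr expR.
  rewrite exprMn sqr_sqrtr ?mulr_ge0 ?ltW// coshR_half; ring.
have E : Num.sqrt (2 / b) * Num.sqrt (2 * b) = 2.
  rewrite -sqrtrM ?divr_ge0 ?ltW//.
  have -> : 2 / b * (2 * b) = 2 ^+ 2 by field; rewrite gt_eqF.
  by rewrite sqrtr_sqr ger0_norm.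
rewrite mulr0 mulr0 add0r mulr1.
set g := gauss_fun _; set u := Num.sqrt (2 / b) in E *.
set v := Num.sqrt (2 * b) in E *.
transitivity (expR (- b) * g * coshR (t / 2) * (u * v / 2)); first by field.
by rewrite E divff// mulr1.
Qed.

(** The closed form of K_{1/2}(b). *)
Lemma Rintegral_expR_coshR_half (R : realType) (b : R) : 0 < b ->
  \int[lebesgue_measure]_(t in `[0%R, +oo[)
      (expR (- (b * coshR t)) * coshR (t / 2)) =
    expR (- b) * Num.sqrt (pi / (2 * b)) /\
  lebesgue_measure.-integrable `[0%R, +oo[
    (EFin \o (fun t => expR (- (b * coshR t)) * coshR (t / 2))).
Proof.
move=> b0.
pose C := expR (- b) * Num.sqrt (2 / b).
have sb0 : 0 < Num.sqrt (2 * b) by rewrite sqrtr_gt0 mulr_gt0.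
have cf : continuous (fun t : R => expR (- (b * coshR t)) * coshR (t / 2)).
  have d (t : R) :
      derivable (fun t : R => expR (- (b * coshR t)) * coshR (t / 2)) t 1.
    by apply: ex_derive.
  by move=> t; apply: differentiable_continuous; apply/derivable1_diffP.
have f0 t : 0 <= t -> 0 <= expR (- (b * coshR t)) * coshR (t / 2).
  by move=> _; rewrite mulr_ge0 ?expR_ge0// ltW// coshR_gt0.
have arg_cvg : Num.sqrt (2 * b) * sinhR (t / 2) @[t --> +oo] --> +oo.
  apply: (@ger_cvgy _ _ _ _ (fun t => Num.sqrt (2 * b) / 2 * t)).
    near=> t; have t0 : 0 <= t by near: t; exact: nbhs_pinfty_ge.
    rewrite -mulrA ler_wpM2l ?(ltW sb0)// mulrC.
    by apply: sinhR_ge_id; rewrite divr_ge0.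
  by apply: gt0_cvgMry; [rewrite divr_gt0|exact: cvg_id].
have F_cvg :
    C * gauss_primitive (Num.sqrt (2 * b) * sinhR (t / 2)) @[t --> +oo] -->
    C * (gauss_primitive 0 + Num.sqrt pi / 2).
  apply: cvgM; first exact: cvg_cst.
  exact: (cvg_comp _ _ arg_cvg (@gauss_primitive_cvg R)).
have := Rintegral_FTC2y f0 cf (fun t => is_derive_gauss_sinhR t b0) F_cvg.
move=> [-> ?]; split => //.
rewrite mul0r sinhR0 mulr0 -mulrBr addrAC subrr add0r /C -mulrA; congr (_ * _).
have -> : pi / (2 * b) = (2 / b) * pi / 2 ^+ 2 :> R by field; rewrite gt_eqF.
have p0 : 0 <= 2 / b by rewrite divr_ge0// ltW.
rewrite [RHS]sqrtrM; last by rewrite mulr_ge0 ?pi_ge0.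
by rewrite (sqrtrM pi p0) sqrtrV// sqrtr_sqr ger0_norm// mulrA.
Unshelve. all: by end_near. Qed.

(** Shift the contour, then bound the cosine by 1: the sum over t and -t leaves 2 cosh(t/2), hence
    K_{1/2}(x cos th). *)
Lemma Rintegral_wave_le (R : realType) (x tau c th : R) :
  0 < x -> 0 <= tau -> 0 < th < pi / 2 ->
  `|\int[lebesgue_measure]_(t in `[0%R, +oo[)
      (wave x tau c 0 t + wave x tau c 0 (- t))| <=
  2 * expR (- (tau * th)) * Num.sqrt (pi / (2 * (x * cos th))).
Proof.
move=> x0 tau0 thI; have /andP[th0 thpi] := thI.
have cth : 0 < cos th by rewrite cos_gt0_pihalf//; apply/andP; split; lra.
have b0 : 0 < x * cos th by rewrite mulr_gt0.
have thn : `|th| < pi / 2 by rewrite gtr0_norm.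
have intw := wave_integrable c x0 tau0 thn.
have [Ib ib] := Rintegral_expR_coshR_half b0.
rewrite (Rintegral_wave_shift c x0 tau0 thI).
apply: (le_trans (le_normr_Rintegral _ intw)) => //.
have wave_le t : `|wave x tau c th t| <=
    expR (- (tau * th)) * (expR (- (x * cos th * coshR t)) * expR (t / 2)).
  rewrite /wave normrM (ger0_norm (expR_ge0 _)) -!expRD -[leRHS]mulr1 ler_pM
    ?expR_ge0//.
    by rewrite ler_expR; lra.
  by rewrite ler_norml cos_geN1 cos_le1.
pose g t : R := 2 * expR (- (tau * th)) *
  (expR (- (x * cos th * coshR t)) * coshR (t / 2)).
have intg : lebesgue_measure.-integrable `[0%R, +oo[ (EFin \o g).
  by apply: eq_integrable (integrableZl _ (2 * expR (- (tau * th))) ib).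
apply: (@le_trans _ _ (\int[lebesgue_measure]_(t in `[0%R, +oo[) g t)).
  apply: le_Rintegral => //; first exact: integrable_norm.
  move=> t _; rewrite (le_trans (ler_normD _ _))//.
  apply: (le_trans (lerD (wave_le t) (wave_le (- t)))).
  by rewrite coshRN mulNr /g /coshR le_eqVlt; apply/orP; left; apply/eqP; field.
rewrite /g RintegralZl// Ib ler_wpM2l ?mulr_ge0 ?expR_ge0//.
(* The factor exp(-x cos th) of the closed form is bounded by 1. *)
rewrite ler_piMl ?sqrtr_ge0// expR_le1; lra.
Qed.

(** * The optimal angle and the conclusion *)

Lemma optimal_shift_le (R : realType) (tau x : R) : 0 < x -> 0 < tau ->
  expR (- (tau * atan (2 * tau))) *
    Num.sqrt (pi / (2 * (x * cos (atan (2 * tau))))) <=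
  Num.sqrt (pi ^+ 2 * tau / (2 * x * sinhR (pi * tau))).
Proof.
move=> x0 tau0; have T0 : 0 < 2 * tau by rewrite mulr_gt0.
(* Squaring both sides and removing the common factor pi/(2x) turns the claim into this inequality
   at T = 2 tau. *)
have := sinhR_pihalf_le_shift_gain T0; rewrite /shift_gain.
have -> : pi / 2 * (2 * tau) = pi * tau by field.
set c := cos _; set a := atan _.
have c0 : 0 < c by exact: cos_atan_gt0.
have S0 : 0 < sinhR (pi * tau) by rewrite sinhR_gt0// mulr_gt0// pi_gt0.
set S := sinhR _ in S0 *.
have -> : expR (2 * tau * a) = (expR (- (tau * a)) ^+ 2)^-1.
  by rewrite -expRM_natl -expRN; congr expR; ring.
set q := expR _; have q0 : 0 < q by exact: expR_gt0.
move=> Sle.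
rewrite -[X in X * _](ger0_norm (ltW q0)) -sqrtr_sqr -sqrtrM ?sqr_ge0//.
rewrite ler_wsqrtr//.
have p0 := @pi_gt0 R.
have -> : q ^+ 2 * (pi / (2 * (x * c))) = pi / (2 * x) * (q ^+ 2 / c).
  by field; rewrite !gt_eqF.
have -> : pi ^+ 2 * tau / (2 * x * S) = pi / (2 * x) * (pi * tau / S).
  by field; rewrite !gt_eqF.
rewrite ler_wpM2l ?divr_ge0 ?mulr_ge0 ?(ltW x0) ?(ltW p0)//.
rewrite ler_pdivlMr// mulrAC ler_pdivrMr//.
have := ler_wpM2l (exprn_ge0 2 (ltW q0)) Sle.
have -> : q ^+ 2 * (pi * tau * (q ^- 2 * c)) = pi * tau * c.
  by field; rewrite gt_eqF.
by [].
Qed.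

Lemma wave0 (R : realType) (x tau c t : R) :
  wave x tau c 0 t = expR (- x * coshR t) * expR (2^-1 * t) * cos (tau * t + c).
Proof.
by rewrite /wave sin0 cos0 -expRD; congr (expR _ * cos _); field.
Qed.

Lemma Re_macdonald (R : realType) (x tau : R) :
  complex.Re (macdonald (2^-1 +i* tau) x) =
  \int[lebesgue_measure]_(t in `[0%R, +oo[)
    (2^-1 * (wave x tau 0 0 t + wave x tau 0 0 (- t))).
Proof.
apply: eq_Rintegral => t _; rewrite !wave0 coshRN /coshC /expC/=.
rewrite !(mulr0, mul0r, subr0, addr0, add0r) !mulrN !cosN !sinN.
by field.
Qed.

(** The phase -pi/2 turns the cosine into a sine, so the wave becomes the imaginary part of the same
    exponential. *)
Lemma Im_macdonald (R : realType) (x tau : R) :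
  complex.Im (macdonald (2^-1 +i* tau) x) =
  \int[lebesgue_measure]_(t in `[0%R, +oo[)
    (2^-1 * (wave x tau (- (pi / 2)) 0 t + wave x tau (- (pi / 2)) 0 (- t))).
Proof.
apply: eq_Rintegral => t _; rewrite !wave0 coshRN /coshC /expC/= !cosBpihalf.
rewrite !(mulr0, mul0r, subr0, addr0, add0r) !mulrN !cosN !sinN.
by field.
Qed.

(** The phase c is arbitrary, so that c = 0 and c = -pi/2 settle the real and imaginary parts at
    once. *)
Lemma normr_half_wave_integral_le (R : realType) (x tau c : R) :
  0 < x -> 0 < tau ->
  `|\int[lebesgue_measure]_(t in `[0%R, +oo[)
      (2^-1 * (wave x tau c 0 t + wave x tau c 0 (- t)))|
    <= Num.sqrt (pi ^+ 2 * tau / (2 * x * sinhR (pi * tau))).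
Proof.
move=> x0 tau0; apply: le_trans (optimal_shift_le x0 tau0).
have n0 : `|0 : R| < pi / 2 by rewrite normr0 divr_gt0 ?pi_gt0.
rewrite RintegralZl//; last exact: wave_integrable (ltW tau0) n0.
have thI : 0 < atan (2 * tau) < pi / 2.
  by rewrite atan_ltpi2 andbT -(@atan0 R) lt_atan// mulr_gt0.
have := Rintegral_wave_le c x0 (ltW tau0) thI.
rewrite normrM (@ger0_norm _ 2^-1) ?invr_ge0//.
by lra.
Qed.

Theorem mainTheorem8 (R : realType) (x tau : R) (hx : 0 < x) (htau : 0 < tau) :
  `|complex.Re (macdonald (2^-1 +i* tau) x)|
    <= Num.sqrt (pi ^+ 2 * tau / (2 * x * sinhR (pi * tau))) /\
  `|complex.Im (macdonald (2^-1 +i* tau) x)|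
    <= Num.sqrt (pi ^+ 2 * tau / (2 * x * sinhR (pi * tau))).
Proof.
by split; rewrite ?Re_macdonald ?Im_macdonald;
  exact: normr_half_wave_integral_le.
Qed.
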